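(* Let $A\in\mathbb{H}^{k\times k}$ be invertible. (1) Let $u,v\in\mathbb{H}^k$. If $1+v^*A^{-1}u\ne 0$, then $A+uv^*$ is invertible and $$(A+uv^* )^{-1}=A^{-1}-A^{-1}u\left(1+v^*A^{-1}u\right)^{-1}v^*A^{-1}.$$ (2) (Column replacement.) Let $A_{\rm new}$ be obtained from $A$ by replacing its $q$th column $a_q$ by a column $b\in\mathbb{H}^k$, so that $A_{\rm new}=A+(b-a_q)e_q^*$. If $1+e_q^*A^{-1}(b-a_q)\ne 0$, then $$A_{\rm new}^{-1}=A^{-1}-A^{-1}(b-a_q)\left(1+e_q^*A^{-1}(b-a_q)\right)^{-1}e_q^*A^{-1}.$$ (3) (Row replacement.) Let $A_{\rm new}$ be obtained from $A$ by replacing its $q$th row, denoted $a_q^*$, by a row $b^*$ with $b\in\mathbb{H}^k$, so that $A_{\rm new}=A+e_q(b^*-a_q^* )$. If $1+(b^*-a_q^* )A^{-1}e_q\ne 0$, then $$A_{\rm new}^{-1}=A^{-1}-A^{-1}e_q\left(1+(b^*-a_q^* )A^{-1}e_q\right)^{-1}(b^*-a_q^* )A^{-1}.$$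
   Context: $\mathbb{H}$ is the skew field of real quaternions; $M^*$ is the conjugate transpose of a quaternion matrix. Elements of $\mathbb{H}^k$ are column vectors, and $e_q$ is the $q$th standard basis column vector. Invertible means having a two-sided inverse over $\mathbb{H}$. In part (2), $a_q$ is the $q$th column of $A$; in part (3), $a_q^*$ denotes the $q$th row of $A$. *)

(* Defs.v *)
From HB Require Import structures.
From mathcomp Require Import all_boot all_order all_algebra.
From mathcomp Require Import ring.
From mathcomp Require Import boolp classical_sets reals.

Set Implicit Arguments.
Unset Strict Implicit.
Unset Printing Implicit Defensive.

Import Order.TTheory GRing.Theory Num.Theory.

Local Open Scope ring_scope.

(* Quat a b c d stands for a + b i + c j + d k. *)
Record quaternion (R : realType) := Quat { q_re : R; q_i : R; q_j : R; q_k : R }.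

Section Quaternion.
Variable R : realType.
Local Notation H := (quaternion R).
Implicit Types x y z : H.

Definition tuple_of_quat x := (q_re x, q_i x, q_j x, q_k x).
Definition quat_of_tuple (t : R * R * R * R) : H :=
  let: (a, b, c, d) := t in Quat a b c d.

Lemma tuple_of_quatK : cancel tuple_of_quat quat_of_tuple.
Proof. by case. Qed.

HB.instance Definition _ := Choice.copy H (can_type tuple_of_quatK).

Definition addq x y : H :=
  Quat (q_re x + q_re y) (q_i x + q_i y) (q_j x + q_j y) (q_k x + q_k y).
Definition oppq x : H := Quat (- q_re x) (- q_i x) (- q_j x) (- q_k x).

Lemma addqA : associative addq.
Proof. by move=> x y z; rewrite /addq /= !addrA. Qed.
Lemma addqC : commutative addq.
Proof. by move=> [? ? ? ?] [? ? ? ?]; congr Quat; rewrite /= addrC. Qed.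
Lemma add0q : left_id (Quat 0 0 0 0) addq.
Proof. by case=> *; rewrite /addq /= !add0r. Qed.
Lemma addNq : left_inverse (Quat 0 0 0 0) oppq addq.
Proof. by case=> *; rewrite /addq /= !addNr. Qed.

HB.instance Definition _ := GRing.isZmodule.Build H addqA addqC add0q addNq.

Definition mulq x y : H :=
  let: Quat a b c d := x in let: Quat a' b' c' d' := y in
  Quat (a * a' - b * b' - c * c' - d * d')
       (a * b' + b * a' + c * d' - d * c')
       (a * c' - b * d' + c * a' + d * b')
       (a * d' + b * c' - c * b' + d * a').

Lemma mulqA : associative mulq.
Proof. by move=> [? ? ? ?] [? ? ? ?] [? ? ? ?]; congr Quat; ring. Qed.
Lemma mul1q : left_id (Quat 1 0 0 0) mulq.
Proof. by case=> *; congr Quat; ring. Qed.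
Lemma mulq1 : right_id (Quat 1 0 0 0) mulq.
Proof. by case=> *; congr Quat; ring. Qed.
Lemma mulqDl : left_distributive mulq +%R.
Proof. by move=> [? ? ? ?] [? ? ? ?] [? ? ? ?]; congr Quat; rewrite /=; ring. Qed.
Lemma mulqDr : right_distributive mulq +%R.
Proof. by move=> [? ? ? ?] [? ? ? ?] [? ? ? ?]; congr Quat; rewrite /=; ring. Qed.
Lemma oneq_neq0 : Quat 1 0 0 0 != 0 :> H.
Proof. by apply/eqP => -[] /eqP; rewrite oner_eq0. Qed.

HB.instance Definition _ :=
  GRing.Zmodule_isNzRing.Build H mulqA mul1q mulq1 mulqDl mulqDr oneq_neq0.

Definition conjq x : H := Quat (q_re x) (- q_i x) (- q_j x) (- q_k x).
Definition sqnormq x : R := q_re x ^+ 2 + q_i x ^+ 2 + q_j x ^+ 2 + q_k x ^+ 2.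
Definition invq x : H :=
  let n := sqnormq x in
  Quat (q_re x / n) (- q_i x / n) (- q_j x / n) (- q_k x / n).
Definition unitq : pred H := fun x => x != 0.

Lemma sqnormq_eq0 x : (sqnormq x == 0) = (x == 0).
Proof.
apply/eqP/eqP => [|->]; last by rewrite /sqnormq /= !expr0n /= !addr0.
case: x => a b c d /eqP; rewrite /sqnormq /=.
rewrite !paddr_eq0 ?addr_ge0 ?sqr_ge0 // !sqrf_eq0.
by move=> /andP[/andP[/andP[/eqP-> /eqP->] /eqP->] /eqP->].
Qed.

Lemma mulVq : {in unitq, left_inverse 1 invq *%R}.
Proof.
move=> x; rewrite unfold_in -sqnormq_eq0; case: x => a b c d n0.
by congr Quat; rewrite /= /sqnormq /= in n0 *; field.
Qed.

Lemma mulqV : {in unitq, right_inverse 1 invq *%R}.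
Proof.
move=> x; rewrite unfold_in -sqnormq_eq0; case: x => a b c d n0.
by congr Quat; rewrite /= /sqnormq /= in n0 *; field.
Qed.

Lemma unitqP x y : y * x = 1 /\ x * y = 1 -> unitq x.
Proof.
move=> [yx1 _]; apply/eqP => x0; move: yx1; rewrite x0 mulr0 => /eqP.
by rewrite eq_sym oner_eq0.
Qed.

Lemma invq_out : {in [predC unitq], invq =1 id}.
Proof.
move=> x; rewrite inE unfold_in negbK => /eqP ->.
by congr Quat; rewrite /= ?oppr0 mul0r.
Qed.

HB.instance Definition _ :=
  GRing.NzRing_hasMulInverse.Build H mulVq mulqV unitqP invq_out.

Definition ctrmx m n (M : 'M[H]_(m, n)) : 'M[H]_(n, m) := map_mx conjq M^T.

End Quaternion.

Notation "M ^*m" := (ctrmx M) (at level 1, format "M ^*m") : ring_scope.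

(* The library's unitmx and invmx need a commutative ring; these are the
   two-sided notions over an arbitrary one. *)
Section NonCommutativeInverse.
Variables (D : nzRingType) (n : nat).
Implicit Types A B : 'M[D]_n.

Definition is_mxinv A B := A *m B = 1%:M /\ B *m A = 1%:M.

Definition mxinvertible A := exists B, is_mxinv A B.

(* Like invmx, equal to A itself when A is not invertible. *)
Definition mxinv A : 'M[D]_n := xget A [set B | is_mxinv A B]%classic.

Lemma mxinvP A : mxinvertible A -> is_mxinv A (mxinv A).
Proof. exact: xgetPex. Qed.

Lemma mxinv_uniq A B : is_mxinv A B -> mxinv A = B.
Proof.
move=> [AB BA]; have [_ VA] : is_mxinv A (mxinv A) by apply: mxinvP; exists B.
by rewrite -[LHS]mulmx1 -AB mulmxA VA mul1mx.
Qed.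

End NonCommutativeInverse.

Definition replace_col (T : Type) m n (A : 'M[T]_(m, n)) (q : 'I_n)
    (b : 'cV[T]_m) : 'M[T]_(m, n) :=
  \matrix_(i, j) if j == q then b i ord0 else A i j.

Definition replace_row (T : Type) m n (A : 'M[T]_(m, n)) (q : 'I_m)
    (r : 'rV[T]_n) : 'M[T]_(m, n) :=
  \matrix_(i, j) if i == q then r ord0 j else A i j.

Definition std_basis (D : nzRingType) n (q : 'I_n) : 'cV[D]_n := delta_mx q ord0.
Arguments std_basis {D n} q.

(* Main.v *)
Require Import Defs.
From mathcomp Require Import all_boot all_order all_algebra.
From mathcomp Require Import reals.
Import GRing.Theory.
Local Open Scope ring_scope.

(** With [S = 1 + w V u] the capacitance matrix, [w V] satisfies
    [w (V - V u S^-1 w V) = S^-1 w V], since [w V u = S - 1]; the right inverse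
    identity follows, and the left one is symmetric. The argument needs only that
    [S] has a two-sided inverse, so the rank of the update is irrelevant. *)

Lemma woodbury (D : nzRingType) (k m : nat) (A V : 'M[D]_k)
    (u : 'M[D]_(k, m)) (w : 'M[D]_(m, k)) (T : 'M[D]_m) :
  is_mxinv A V -> is_mxinv (1%:M + w *m V *m u) T ->
  is_mxinv (A + u *m w) (V - V *m u *m T *m w *m V).
Proof.
move=> [AV VA] [ST TS]; split.
  have wE : w *m (V - V *m u *m T *m w *m V) = T *m w *m V.
    (* Right multiplication of [ST] by [w V] reads [T w V + w V u T w V = w V]. *)
    have := congr1 (fun M => M *m (w *m V)) ST.
    rewrite !mulmxDl !mul1mx !mulmxA => E.
    by apply/eqP; rewrite mulmxBr !mulmxA subr_eq E.
  (* The product becomes [1 - u T w V + u T w V]. *)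
  rewrite mulmxDl -[u *m w *m _]mulmxA wE mulmxBr AV !mulmxA AV mul1mx.
  by rewrite addrNK.
have uE : (V - V *m u *m T *m w *m V) *m u = V *m u *m T.
  (* Mirror image: [TS] multiplied on the left by [V u]. *)
  have := congr1 (fun M => V *m u *m M) TS.
  rewrite !mulmxDr !mulmx1 !mulmxA => E.
  by apply/eqP; rewrite mulmxBl subr_eq E.
rewrite mulmxDr mulmxA uE mulmxBl VA -[_ *m V *m A]mulmxA VA mulmx1.
by rewrite addrNK.
Qed.

Lemma is_mxinv_mxinv (D : nzRingType) (n : nat) (A B : 'M[D]_n) :
  is_mxinv A B -> mxinvertible A /\ mxinv A = B.
Proof. by move=> AB; split; [exists B | apply: mxinv_uniq]. Qed.

(** The case [m = 1] with [T = (s^-1)%:M]. The row [w] is arbitrary, so that it can be [v^*m] as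
    well as a difference of rows. *)
Lemma sherman_morrison (R : realType) (k : nat) (A : 'M[quaternion R]_k)
    (u : 'cV[quaternion R]_k) (w : 'rV[quaternion R]_k)
    (s := 1 + (w *m mxinv A *m u) ord0 ord0) :
  mxinvertible A -> s != 0 ->
  mxinvertible (A + u *m w) /\
  mxinv (A + u *m w) =
    mxinv A - mxinv A *m u *m (s^-1)%:M *m w *m mxinv A.
Proof.
(* Quaternion units are by definition the nonzero elements, so [s0] is the unit claim. *)
move=> hA s0; have us : s \is a GRing.unit by [].
apply/is_mxinv_mxinv/woodbury; first exact: mxinvP.
(* A 1 by 1 matrix is the scalar matrix of its entry, so inverting it amounts to inverting [s]. *)
have -> : 1%:M + w *m mxinv A *m u = s%:M.
  by rewrite [w *m _ *m _]mx11_scalar -raddfD.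
by split; rewrite -scalar_mxM ?divrr ?mulVr.
Qed.

(** The entries 0 and 1 are real, hence fixed by conjugation. *)
Lemma ctrmx_std_basis (R : realType) (k : nat) (q : 'I_k) :
  (std_basis q : 'cV[quaternion R]_k)^*m = delta_mx ord0 q.
Proof.
apply/matrixP => i j; rewrite !mxE andbC.
by case: (_ && _); congr Quat; rewrite /= oppr0.
Qed.

(** The outer product vanishes off column [q], where its [- col q A] part cancels the old
    entries. *)
Lemma replace_colE (D : nzRingType) (m n : nat) (A : 'M[D]_(m, n)) (q : 'I_n)
    (b : 'cV[D]_m) :
  replace_col A q b = A + (b - col q A) *m delta_mx ord0 q.
Proof.
apply/matrixP => i j; rewrite !mxE big_ord1 !mxE eqxx /=.
by case: eqP => [->|_]; rewrite ?mulr1 ?mulr0 ?addr0 // addrC subrK.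
Qed.

Lemma replace_rowE (D : nzRingType) (m n : nat) (A : 'M[D]_(m, n)) (q : 'I_m)
    (r : 'rV[D]_n) :
  replace_row A q r = A + std_basis q *m (r - row q A).
Proof.
apply/matrixP => i j; rewrite !mxE big_ord1 !mxE eqxx andbT.
by case: eqP => [->|_]; rewrite ?mul1r ?mul0r ?addr0 // addrC subrK.
Qed.

Theorem mainTheorem8 (R : realType) (k : nat) (A : 'M[quaternion R]_k)
    (hA : mxinvertible A) :
  (* (1) *)
  (forall u v : 'cV[quaternion R]_k,
     let s : quaternion R := 1 + (v^*m *m mxinv A *m u) ord0 ord0 in
     s != 0 ->
     mxinvertible (A + u *m v^*m) /\
     mxinv (A + u *m v^*m) =
       mxinv A - mxinv A *m u *m (s^-1)%:M *m v^*m *m mxinv A)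
  /\
  (* (2) *)
  (forall (q : 'I_k) (b : 'cV[quaternion R]_k),
     let a_q := col q A in
     let e_q : 'cV[quaternion R]_k := std_basis q in
     let Anew := replace_col A q b in
     let s : quaternion R := 1 + (e_q^*m *m mxinv A *m (b - a_q)) ord0 ord0 in
     Anew = A + (b - a_q) *m e_q^*m /\
     (s != 0 ->
      mxinvertible Anew /\
      mxinv Anew =
        mxinv A - mxinv A *m (b - a_q) *m (s^-1)%:M *m e_q^*m *m mxinv A))
  /\
  (* (3): [row q A] is the row denoted a_q^* *)
  (forall (q : 'I_k) (b : 'cV[quaternion R]_k),
     let e_q : 'cV[quaternion R]_k := std_basis q in
     let Anew := replace_row A q b^*m in
     let s : quaternion R :=
       1 + ((b^*m - row q A) *m mxinv A *m e_q) ord0 ord0 in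
     Anew = A + e_q *m (b^*m - row q A) /\
     (s != 0 ->
      mxinvertible Anew /\
      mxinv Anew =
        mxinv A
        - mxinv A *m e_q *m (s^-1)%:M *m (b^*m - row q A) *m mxinv A)).
Proof.
split=> [u v s s0|]; first exact: sherman_morrison.
split=> q b.
  move=> a_q e_q Anew s.
  have AnewE : Anew = A + (b - a_q) *m e_q^*m.
    by rewrite ctrmx_std_basis -replace_colE.
  by split=> // s0; rewrite AnewE; exact: sherman_morrison.
move=> e_q Anew s; split=> [|s0]; first exact: replace_rowE.
(* Here [u] is [e_q] and [w] is [b^*m - row q A]. *)
by rewrite /Anew replace_rowE; exact: sherman_morrison.
Qed.
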